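(* Let $(W,S)$ be an irreducible Coxeter system of rank $n$ equipped with a bilinear form $B$ of signature $(n-1,1)$, and let $E$ be the set of accumulation points of normalized roots. Then for every $x\in E$, $$\overline{W\cdot x}=E,$$ where $W\cdot x$ is the orbit of $x$ under the normalized action.
   Context: Setting: $(W,S)$ is a Coxeter system of rank $n$, $S=\{s_1,\dots,s_n\}$, with relations $(s_is_j)^{m_{ij}}=1$, $m_{ii}=1$, $m_{ij}=m_{ji}\in\mathbb{Z}_{>1}\cup\{\infty\}$ for $i\ne j$; it is irreducible if its Coxeter graph is connected. $V=\mathbb{R}^n$ is a Euclidean space with orthonormal basis $\Delta=\{\alpha_1,\dots,\alpha_n\}$ (simple roots, $\alpha_i$ corresponding to $s_i$). $B$ is a symmetric bilinear form on $V$ (identified with its matrix in the basis $\Delta$) with $B(\alpha_i,\alpha_i)=1$, $B(\alpha_i,\alpha_j)=-\cos(\pi/m_{ij})$ if $m_{ij}<\infty$, and $B(\alpha_i,\alpha_j)$ any real number $\le -1$ if $m_{ij}=\infty$. $W$ acts linearly on $V$ with $s_i$ acting as $s_{\alpha_i}(v)=v-2B(\alpha_i,v)\alpha_i$. The root system is $\Phi=W(\Delta)$. Normalization: since $B$ has signature $(n-1,1)$, let $o=\sum_i o_i\alpha_i$ be the eigenvector of Euclidean norm $1$ of the matrix $B$ for its negative eigenvalue with all $o_i>0$ (it exists). Put $|v|_1=\sum_i o_iv_i$ for $v=\sum_i v_i\alpha_i$, $V_0=\{v:|v|_1=0\}$, $V_1=\{v:|v|_1=1\}$, $\widehat{v}=v/|v|_1$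 for $v\notin V_0$. Let $\widehat{Q}=\{x\in V_1: B(x,x)=0\}$. The normalized action is $w\cdot x=\widehat{w(x)}$ for $w\in W$ and $x\in V_1\setminus W(V_0)$; it is well defined on $\widehat{Q}$ and preserves it. All roots lie outside $V_0$, and $E\subset\widehat{Q}$ is the set of all limits of injective sequences of normalized roots $\widehat{\rho}$, $\rho\in\Phi$. The overline denotes topological closure. *)

(* Defs.v *)
From HB Require Import structures.
From mathcomp Require Import all_boot all_order all_algebra.
From mathcomp Require Import all_classical all_reals all_analysis.

Set Implicit Arguments.
Unset Strict Implicit.
Unset Printing Implicit Defensive.

Import Order.TTheory GRing.Theory Num.Theory.
Import numFieldNormedType.Exports.

Local Open Scope classical_set_scope.
Local Open Scope ring_scope.

(* [m i j = Some k] encodes m_ij = k and [m i j = None] encodes m_ij = oo. *)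
Record coxeter_matrix n (m : 'I_n -> 'I_n -> option nat) : Prop := {
  coxeter_matrix_diag : forall i, m i i = Some 1%N;
  coxeter_matrix_sym : forall i j, m i j = m j i;
  coxeter_matrix_gt1 : forall i j k, i != j -> m i j = Some k -> (1 < k)%N
}.

Definition coxeter_relations n (m : 'I_n -> 'I_n -> option nat)
    (G : groupType) (f : 'I_n -> G) : Prop :=
  forall i j k, m i j = Some k -> ((f i * f j) ^+ k = 1)%g.

(* W = < s_1, ..., s_n | (s_i s_j)^(m_ij) = 1 >: the s_i generate W, satisfy
   the relations, and are universal among families of elements of a group
   satisfying them. *)
Record coxeter_system n (m : 'I_n -> 'I_n -> option nat)
    (W : groupType) (s : 'I_n -> W) : Prop := {
  coxeter_system_matrix : coxeter_matrix m;
  coxeter_system_gen : forall H : set W,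
    H 1%g -> (forall x y, H x -> H y -> H (x * y^-1)%g) ->
    (forall i, H (s i)) -> H = setT;
  coxeter_system_rel : coxeter_relations m s;
  coxeter_system_univ : forall (G : groupType) (f : 'I_n -> G),
    coxeter_relations m f ->
    exists h : {multiplicative W -> G}, forall i, h (s i) = f i
}.

(* In the Coxeter graph, i and j are adjacent when m_ij >= 3 or m_ij = oo. *)
Definition coxeter_edge n (m : 'I_n -> 'I_n -> option nat) : rel 'I_n :=
  fun i j => (i != j) && (m i j != Some 2%N).

Definition coxeter_irreducible n (m : 'I_n -> 'I_n -> option nat) : Prop :=
  forall i j, connect (coxeter_edge m) i j.

Section Geometry.
Variables (R : realType) (n : nat).
Implicit Types (m : 'I_n -> 'I_n -> option nat) (B : 'M[R]_n) (u v o x : 'rV[R]_n).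

Definition simple_root (i : 'I_n) : 'rV[R]_n := delta_mx 0 i.

Definition bform B u v : R := (u *m B *m v^T) 0 0.

Record coxeter_form m B : Prop := {
  coxeter_form_sym : forall u v, bform B u v = bform B v u;
  coxeter_form_diag : forall i, bform B (simple_root i) (simple_root i) = 1;
  coxeter_form_fin : forall i j k, i != j -> m i j = Some k ->
    bform B (simple_root i) (simple_root j) = - cos (pi / k%:R);
  coxeter_form_inf : forall i j, i != j -> m i j = None ->
    bform B (simple_root i) (simple_root j) <= -1
}.

(* B has exactly p positive and q negative eigenvalues, with multiplicity. *)
Definition has_signature B (p q : nat) : Prop :=
  exists r : seq R, [/\ char_poly B = \prod_(a <- r) ('X - a%:P),
    count (fun a => 0 < a) r = p & count (fun a => a < 0) r = q].

Record coxeter_action (W : groupType) (s : 'I_n -> W) B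
    (act : W -> 'rV[R]_n -> 'rV[R]_n) : Prop := {
  coxeter_action_linear : forall w, linear (act w);
  coxeter_action1 : forall v, act 1%g v = v;
  coxeter_actionM : forall w1 w2 v, act (w1 * w2)%g v = act w1 (act w2 v);
  coxeter_action_gen : forall i v,
    act (s i) v = v - (2 * bform B (simple_root i) v) *: simple_root i
}.

Definition euclidean_norm v : R := Num.sqrt (\sum_i v 0 i ^+ 2).

(* As B is symmetric, row eigenvectors and column eigenvectors coincide. *)
Definition normalizing_eigenvector B o : Prop :=
  [/\ exists2 a : R, a < 0 & o *m B = a *: o,
      euclidean_norm o = 1 & forall i, 0 < o 0 i].

Definition norm1 o v : R := \sum_i o 0 i * v 0 i.

(* Only meaningful when [norm1 o v != 0]; otherwise the value is 0. *)
Definition normalize o v : 'rV[R]_n := (norm1 o v)^-1 *: v.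

Definition root_system (W : groupType) (act : W -> 'rV[R]_n -> 'rV[R]_n) :
    set 'rV[R]_n :=
  [set rho | exists w i, rho = act w (simple_root i)].

Definition limit_roots (W : groupType) (act : W -> 'rV[R]_n -> 'rV[R]_n) o :
    set 'rV[R]_n :=
  [set x | exists u : nat -> 'rV[R]_n,
    [/\ injective u, forall k, (normalize o @` root_system act) (u k) &
        u @ \oo --> x]].

Definition normalized_orbit (W : groupType)
    (act : W -> 'rV[R]_n -> 'rV[R]_n) o x : set 'rV[R]_n :=
  [set normalize o (act w x) | w in [set: W]].

End Geometry.

(* Main.v *)
Require Import Defs.
From HB Require Import structures.
From mathcomp Require Import all_boot all_order all_algebra.
From mathcomp Require Import all_classical all_reals all_analysis.
From mathcomp Require Import spectral complex.
From mathcomp Require Import zify ring lra.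

(* Write [N] for [norm1 o] and [r_z] for the reflection in a non-isotropic [z].
   By Tits' argument every root is positive or negative, so an element of [W]
   that keeps [o] in the open fundamental chamber is trivial.  Let [u_k] be
   distinct normalized roots converging to [y].  If [B(y, y)] were nonzero, the
   [r_{u_k}] would converge to the involution [r_y], so [r_{u_k} r_{u_{k+1}}]
   would eventually keep [o] in the chamber, forcing [u_k = u_{k+1}]; hence [y]
   is isotropic.  If [x] is another limit root, then [B(x, y) != 0], because [B]
   is positive definite on [N = 0] and hence at [x - y]; since
   [B(u_k, u_k) -> 0], the point [r_{u_k}(x) = x - 2 B(u_k, x) / B(u_k, u_k) u_k]
   normalizes to a sequence of the orbit of [x] that converges to [y].  The other
   inclusion holds because the set of limit roots is closed and [W]-stable. *)

Set Implicit Arguments.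
Unset Strict Implicit.
Unset Printing Implicit Defensive.

Import Order.TTheory GRing.Theory Num.Theory.
Import numFieldNormedType.Exports.

Local Open Scope classical_set_scope.
Local Open Scope ring_scope.

(** * Word length in a group generated by involutions, and the braid relation *)

Section WordLength.
Variables (I : Type) (W : groupType) (s : I -> W).
Hypothesis s_invol : forall i, (s i * s i = 1)%g.
Hypothesis s_gen : forall w, exists k : nat,
  `[< exists2 t, size t = k & (\prod_(i <- t) s i)%g = w >].

Definition word_length (w : W) : nat := ex_minn (s_gen w).

Lemma word_length_prod t : (word_length (\prod_(i <- t) s i)%g <= size t)%N.
Proof.
by rewrite /word_length; case: ex_minnP => k _; apply; apply/asboolP; exists t.
Qed.

Lemma word_lengthP w : exists2 t, size t = word_length w & (\prod_(i <- t) s i)%g = w.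
Proof. by rewrite /word_length; case: ex_minnP => k /asboolP. Qed.

Lemma word_lengthM w i : (word_length (w * s i)%g <= (word_length w).+1)%N.
Proof.
have [t tw {1}<-] := word_lengthP w; rewrite -tw.
rewrite (_ : (_ * s i)%g = (\prod_(j <- rcons t i) s j)%g).
  by rewrite -(size_rcons t i) word_length_prod.
by rewrite -cats1 big_cat /= big_seq1.
Qed.

Lemma word_length_eq0 w : word_length w = 0%N -> w = 1%g.
Proof.
move=> w0; have [t] := word_lengthP w; rewrite w0 => /size0nil -> <-.
by rewrite big_nil.
Qed.

Lemma word_length_gt0 w : (0 < word_length w)%N ->
  exists i, (word_length (w * s i)%g < word_length w)%N.
Proof.
have [t tw wt] := word_lengthP w; rewrite -tw; move: tw wt.
case/lastP: t => [//|t i] _ <- _; exists i; rewrite size_rcons ltnS.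
rewrite -cats1 big_cat /= big_seq1 -mulgA s_invol mulg1.
exact: word_length_prod.
Qed.

(* The last letter is [s j]. *)
Fixpoint alt_prod (i j : I) (p : nat) : W :=
  (if p is q.+1 then alt_prod j i q * s j else 1)%g.

Lemma alt_prodSS i j p : (alt_prod i j p.+2 = alt_prod i j p * (s i * s j))%g.
Proof. by rewrite /= mulgA. Qed.

Lemma alt_prod_even i j q : (alt_prod i j q.*2 = (s i * s j) ^+ q)%g.
Proof.
by elim: q => [|q IH]; rewrite ?expg0// doubleS alt_prodSS IH expgSr.
Qed.

Lemma alt_prod_odd i j q : (alt_prod i j q.*2.+1 = s j * (s i * s j) ^+ q)%g.
Proof.
elim: q => [|q IH]; first by rewrite expg0 mulg1 [LHS]mul1g.
by rewrite doubleS alt_prodSS IH expgSr -mulgA.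
Qed.

Lemma s_inv i : ((s i)^-1 = s i)%g.
Proof. by apply: mulg1_eq; exact: s_invol. Qed.

(** With [q = k./2], both sides are the power [q] of [s i * s j] or of its inverse [s j * s i],
    preceded by one letter when [k] is odd. The relation then equates them. *)
Lemma alt_prod_braid i j k : ((s i * s j) ^+ k = 1)%g ->
  alt_prod i j k = alt_prod j i k.
Proof.
have E : (s j * s i = (s i * s j)^-1)%g by rewrite invgM !s_inv.
rewrite -(odd_double_half k); set q := k./2.
case: (odd k); rewrite ?add0n ?add1n => h.
  rewrite !alt_prod_odd E expVgn; apply: (mulgI (s i)).
  rewrite [RHS]mulgA s_invol mul1g mulgA -expgS.
  by move: h; rewrite -addnn -addSn expgnDr => /(canRL (mulgK _)); rewrite mul1g.
rewrite !alt_prod_even E expVgn.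
by move: h; rewrite -addnn expgnDr => /(canRL (mulgK _)); rewrite mul1g.
Qed.

End WordLength.

(* Chebyshev polynomials of the second kind, shifted: [sin (p * t) / sin t] at
   [c = cos t]. *)
Fixpoint chebyshev (R : realType) (c : R) (p : nat) : R :=
  match p with
  | 0 => 0
  | p'.+1 => match p' with
             | 0 => 1
             | q.+1 => 2 * c * chebyshev c p' - chebyshev c q
             end
  end.

Arguments chebyshev {R} c p : simpl never.

(** * Sign of the Chebyshev values *)

Section Chebyshev.
Variable R : realType.
Implicit Types (c t : R) (p : nat).

Lemma chebyshev0 c : chebyshev c 0 = 0. Proof. by []. Qed.

Lemma chebyshev1 c : chebyshev c 1 = 1. Proof. by []. Qed.

Lemma chebyshevSS c p :
  chebyshev c p.+2 = 2 * c * chebyshev c p.+1 - chebyshev c p.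
Proof. by []. Qed.

(** This serves the case [m i j = None]. The induction also carries monotonicity in [p], since the
    recursion subtracts the earlier value. *)
Lemma chebyshev_ge0 c p : 1 <= c -> 0 <= chebyshev c p.
Proof.
move=> c1; suff /andP[] :
  (0 <= chebyshev c p) && (chebyshev c p <= chebyshev c p.+1) by [].
elim: p => [|p /andP[h0 h1]]; first by rewrite lexx ler01.
rewrite (le_trans h0 h1) chebyshevSS.
have h2 : 0 <= chebyshev c p.+1 by exact: le_trans h1.
have : 0 <= (c - 1) * chebyshev c p.+1 by rewrite mulr_ge0// subr_ge0.
by move: h1; set x := chebyshev c p; set y := chebyshev c p.+1 => *; nra.
Qed.

Lemma chebyshev_cos (t : R) p :
  sin t * chebyshev (cos t) p = sin (p%:R * t).
Proof.
suff [] : sin t * chebyshev (cos t) p = sin (p%:R * t) /\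
          sin t * chebyshev (cos t) p.+1 = sin (p.+1%:R * t) by [].
elim: p => [|p [IH0 IH1]].
  by rewrite chebyshev0 chebyshev1 mulr0 mul0r sin0 mulr1 mul1r.
split=> //; rewrite chebyshevSS mulrBr IH0 mulrCA IH1.
have -> : p.+2%:R * t = p.+1%:R * t + t by rewrite -[in LHS]natr1 mulrDl mul1r.
have -> : p%:R * t = p.+1%:R * t - t by rewrite -natr1 mulrDl mul1r addrK.
by rewrite !sinD sinN cosN; ring.
Qed.

(** The value is [sin (p * pi / k) / sin (pi / k)], and [p <= k] keeps the upper angle within
    [[0, pi]]. *)
Lemma chebyshev_cos_ge0 k p : (1 < k)%N -> (p <= k)%N ->
  0 <= chebyshev (cos (pi / k%:R) : R) p.
Proof.
move=> k1 pk; have k0 : 0 < k%:R :> R by rewrite ltr0n ltnW.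
have s0 : 0 < sin (pi / k%:R : R).
  apply: sin_gt0_pi; rewrite divr_gt0 ?pi_gt0//=.
  by rewrite ltr_pdivrMr// ltr_pMr ?pi_gt0// ltr1n.
rewrite -(pmulr_rge0 _ s0) chebyshev_cos.
apply: sin_ge0_pi; apply/andP; split.
  by rewrite mulr_ge0// divr_ge0 ?pi_ge0.
rewrite mulrCA ler_piMr ?pi_ge0// ler_pdivrMr// mul1r ler_nat.
exact: pk.
Qed.

End Chebyshev.

(** * Bilinearity of the form *)

Section Bilinear.
Variables (R : realType) (n : nat) (B : 'M[R]_n).
Implicit Types u v w : 'rV[R]_n.

Lemma bformDl u v w : bform B (u + v) w = bform B u w + bform B v w.
Proof. by rewrite /bform !mulmxDl mxE. Qed.

Lemma bformZl a u w : bform B (a *: u) w = a * bform B u w.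
Proof. by rewrite /bform -!scalemxAl mxE. Qed.

Lemma bformDr u v w : bform B w (u + v) = bform B w u + bform B w v.
Proof. by rewrite /bform linearD mulmxDr mxE. Qed.

Lemma bformZr a u w : bform B w (a *: u) = a * bform B w u.
Proof. by rewrite /bform linearZ -scalemxAr mxE. Qed.

Lemma bformNl u w : bform B (- u) w = - bform B u w.
Proof. by rewrite -scaleN1r bformZl mulN1r. Qed.

Lemma bformNr u w : bform B w (- u) = - bform B w u.
Proof. by rewrite -scaleN1r bformZr mulN1r. Qed.

Definition bformE := (bformDl, bformDr, bformNl, bformNr, bformZl, bformZr).

End Bilinear.

(** * Tits' argument: positive and negative roots *)

Section Positivity.
Variables (R : realType) (n : nat).
Variables (m : 'I_n -> 'I_n -> option nat) (W : groupType) (s : 'I_n -> W).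
Variables (B : 'M[R]_n) (act : W -> 'rV[R]_n -> 'rV[R]_n).
Hypotheses (hW : coxeter_system m s) (hB : coxeter_form m B).
Hypothesis hact : coxeter_action s B act.
Implicit Types (w : W) (u v : 'rV[R]_n) (i j : 'I_n).

Local Notation bf := (bform B).
Local Notation alpha := (@simple_root R n).

Definition nonneg_row v := forall k, 0 <= v 0 k.

Lemma generator_invol i : (s i * s i = 1)%g.
Proof.
by have := coxeter_system_rel hW (coxeter_matrix_diag (coxeter_system_matrix hW) i).
Qed.

Lemma generator_word w : exists k : nat,
  `[< exists2 t, size t = k & (\prod_(i <- t) s i)%g = w >].
Proof.
pose H : set W := [set w | exists t, (\prod_(i <- t) s i)%g = w].
suff /(congr1 (@^~ w)) : H = setT.
  rewrite /H /= => E; have [t <-] : exists t, (\prod_(i <- t) s i)%g = w by rewrite E.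
  by exists (size t); apply/asboolP; exists t.
apply: (coxeter_system_gen hW).
- by exists [::]; rewrite big_nil.
- move=> _ _ [t <-] [t' <-]; exists (t ++ rev t'); rewrite big_cat /=; congr (_ * _)%g.
  elim: t' => [|i t' IH]; first by rewrite big_nil invg1.
  rewrite rev_cons -cats1 big_cat /= big_seq1 IH big_cons invgM.
  by rewrite (s_inv generator_invol).
- by move=> i; exists [:: i]; rewrite big_seq1.
Qed.

Local Notation len := (word_length generator_word).

Lemma actD w u v : act w (u + v) = act w u + act w v.
Proof.
by have := coxeter_action_linear hact w 1 u v; rewrite !scale1r.
Qed.

Lemma act0 w : act w 0 = 0.
Proof. by apply: (addIr (act w 0)); rewrite -actD !add0r. Qed.

Lemma actZ w a v : act w (a *: v) = a *: act w v.
Proof.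
by have := coxeter_action_linear hact w a v 0; rewrite act0 !addr0.
Qed.

Lemma actN w v : act w (- v) = - act w v.
Proof. by rewrite -scaleN1r actZ scaleN1r. Qed.

Lemma act_prod_ind (P : W -> Prop) : P 1%g ->
  (forall i w, P w -> P (s i * w)%g) -> forall w, P w.
Proof.
move=> P1 PM w; have [k /asboolP[t _ <-]] := generator_word w.
by elim: t => [|i t IH]; rewrite ?big_nil// big_cons; exact: PM.
Qed.

Lemma bform_act w u v : bf (act w u) (act w v) = bf u v.
Proof.
elim/act_prod_ind: w u v => [|i w IH] u v; first by rewrite !(coxeter_action1 hact).
rewrite !(coxeter_actionM hact) !(coxeter_action_gen hact) !bformE IH.
rewrite (coxeter_form_diag hB) (coxeter_form_sym hB (act w u) (alpha i)); ring.
Qed.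

Lemma act_simple_root i j : i != j -> act (s i) (alpha j) =
  alpha j + (2 * - bf (alpha i) (alpha j)) *: alpha i.
Proof. by move=> ij; rewrite (coxeter_action_gen hact) mulrN scaleNr. Qed.

Lemma act_simple_root_self i : act (s i) (alpha i) = - alpha i.
Proof.
rewrite (coxeter_action_gen hact) (coxeter_form_diag hB) mulr1 scaler_nat mulr2n.
by rewrite opprD addrA subrr sub0r.
Qed.

(** Applying the last letter [s j] turns the coefficient [chebyshev c k] of [alpha j] into
    [chebyshev c k.+2], by the recursion. The vector keeps its shape, with [i] and [j] exchanged and
    [k] increased by one. General [k] serves this induction; at [k = 0] the vector is [alpha i]. *)
Lemma alt_prod_act i j (c := - bf (alpha i) (alpha j)) p k : i != j ->
  (forall q, (q <= p + k.+1)%N -> 0 <= chebyshev c q) ->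
  exists a b, [/\ 0 <= a, 0 <= b &
    act (alt_prod s i j p) (chebyshev c k *: alpha j + chebyshev c k.+1 *: alpha i)
      = a *: alpha i + b *: alpha j].
Proof.
rewrite /c; elim: p i j k {c} => [|p IH] i j k ij h.
  exists (chebyshev (- bf (alpha i) (alpha j)) k.+1).
  exists (chebyshev (- bf (alpha i) (alpha j)) k).
  by rewrite !h ?add0n// (coxeter_action1 hact) addrC.
have ji : j != i by rewrite eq_sym.
have [|b [a [b0 a0 e]]] := IH j i k.+1 ji.
  by rewrite (coxeter_form_sym hB) => q; rewrite addnS => /h.
exists a, b; split=> //; rewrite [RHS]addrC -e /= (coxeter_actionM hact); congr (act _ _).
rewrite actD !actZ act_simple_root_self act_simple_root// (coxeter_form_sym hB).
rewrite chebyshevSS; move: (bf _ _) (chebyshev _ k) (chebyshev _ k.+1) => x C D.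
by apply/rowP => l; rewrite !mxE; ring.
Qed.

Lemma chebyshev_form_ge0 i j p : i != j ->
  (forall k, m i j = Some k -> (p <= k)%N) ->
  0 <= chebyshev (- bf (alpha i) (alpha j)) p.
Proof.
move=> ij h; case E : (m i j) => [k|].
  rewrite (coxeter_form_fin hB ij E) opprK chebyshev_cos_ge0 ?h//.
  exact: (coxeter_matrix_gt1 (coxeter_system_matrix hW) ij E).
by apply: chebyshev_ge0; rewrite lerNr; exact: (coxeter_form_inf hB ij E).
Qed.

(* Let [s j] be a last letter of [w].  Split off from [w = v * alt] a longest
   alternating suffix in [s i] and [s j], of length at most [m i j].  The
   induction hypothesis applies to [v], and [alt] maps [alpha i] to a nonnegative
   combination of [alpha i] and [alpha j]. *)
Lemma nonneg_act w i : (len w <= len (w * s i)%g)%N ->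
  nonneg_row (act w (alpha i)).
Proof.
have [l] := ubnP (len w); elim: l w i => // l IHl w i; rewrite ltnS => wl wi.
have [w0|w0] := posnP (len w).
  rewrite (word_length_eq0 w0) (coxeter_action1 hact) => k.
  by rewrite mxE ler0n.
have [j wj] := word_length_gt0 generator_invol w0.
have ij : i != j.
  by apply: contraTneq wj => <-; rewrite -leqNgt.
pose P p := `[< (exists2 v, w = (v * alt_prod s i j p)%g & (len w = len v + p)%N) /\
  forall k, m i j = Some k -> (p <= k)%N >].
have lens (x : W) k : (len (x * s k)%g <= (len x).+1)%N by exact: word_lengthM.
have sK (x : W) k : (x * s k * s k = x)%g by rewrite -mulgA generator_invol mulg1.
have P1 : P 1%N.
  apply/asboolP; split; last first.
    move=> k /(coxeter_matrix_gt1 (coxeter_system_matrix hW) ij); exact: ltnW.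
  exists (w * s j)%g; first by rewrite /= mul1g sK.
  by apply/eqP; rewrite eqn_leq addn1 wj -{1}(sK w j) lens.
have Pw p : P p -> (p <= len w)%N by move/asboolP => [[x _ ->] _]; rewrite leq_addl.
have exP : exists p, P p by exists 1%N.
case: (ex_maxnP exP Pw) => p /asboolP[[v wv lv] pm] pmax.
have p1 : (0 < p)%N by exact: pmax P1.
have altlen i' j' q (x : W) : (len (x * alt_prod s i' j' q)%g <= len x + q)%N.
  elim: q i' j' => [|q IH] i' j'; first by rewrite mulg1 addn0.
  by rewrite /= mulgA (leq_trans (lens _ _))// addnS ltnS.
(* If [p = m i j], the braid relation would make the suffix end in [s i], so [w * s i] would be
   shorter than [w]. *)
have pm' k : m i j = Some k -> (p < k)%N.
  move=> mk; rewrite ltn_neqAle pm// andbT; apply/eqP => pk; subst k.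
  have := wi; rewrite leqNgt => /negP; apply.
  rewrite lv {lv} wv -mulgA (alt_prod_braid generator_invol); last first.
    exact: (coxeter_system_rel hW mk).
  move=> {pm pmax mk}; case: p p1 => // p _.
  rewrite /= sK.
  by rewrite (leq_ltn_trans (altlen _ _ _ _))// addnS.
(* [x] indexes the first letter of the alternating product, and [y] the letter that prolongs it on
   the left. *)
have first_letter q i' j' : exists x y,
    [/\ forall v : W,
          (v * alt_prod s i' j' q.+1 = v * s x * alt_prod s i' j' q)%g,
        forall v : W,
          (v * s y * alt_prod s i' j' q.+1 = v * alt_prod s i' j' q.+2)%g &
        (x, y) = (i', j') \/ (x, y) = (j', i')].
  elim: q i' j' => [|q IH] i' j'.
    exists j', i'; split; last by right.
      by move=> u /=; rewrite !mulg1 !mul1g.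
    by move=> u; rewrite /= !mul1g !mulgA.
  have [x [y [h1 h2 h3]]] := IH j' i'; exists x, y; split.
  - move=> u; have -> : (alt_prod s i' j' q.+2 = alt_prod s j' i' q.+1 * s j')%g by [].
    by rewrite mulgA h1 -mulgA.
  - move=> u; have -> : (alt_prod s i' j' q.+2 = alt_prod s j' i' q.+1 * s j')%g by [].
    by rewrite mulgA h2 -mulgA.
  - by case: h3 => [] [-> ->]; [right|left].
case: p p1 wv lv pm pm' pmax => // p _ wv lv pm pm' pmax.
have [x [y [vx vy xy]]] := first_letter p i j.
(* Otherwise [w], which is [v * s x] followed by [p] letters, would be shorter than
   [len v + p.+1]. *)
have lvx : (len v <= len (v * s x)%g)%N.
  rewrite leqNgt; apply/negP => h.
  have := altlen i j p (v * s x)%g; rewrite -vx -wv lv; lia.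
(* Otherwise splitting off one more letter would give [P p.+2], against maximality; the strict bound
   [pm'] leaves room for it. *)
have lvy : (len v <= len (v * s y)%g)%N.
  rewrite leqNgt; apply/negP => h.
  have wE : w = (v * s y * alt_prod s i j p.+2)%g by rewrite -vy sK.
  suff /pmax : P p.+2 by rewrite ltnn.
  apply/asboolP; split; last by move=> k /pm'.
  exists (v * s y)%g => //.
  have := altlen i j p.+2 (v * s y)%g; rewrite -wE lv; lia.
have vl : (len v < l)%N by lia.
have nij : nonneg_row (act v (alpha i)) /\ nonneg_row (act v (alpha j)).
  by case: xy lvx lvy => [] [-> ->] *; split; exact: IHl.
have [|a [b [a0 b0 e]]] := @alt_prod_act i j p.+1 0 ij.
  move=> q; rewrite addn1 => qp; apply: chebyshev_form_ge0 => // k /pm'.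
  exact: leq_trans.
move: e; rewrite chebyshev0 chebyshev1 scale0r add0r scale1r => e.
rewrite wv (coxeter_actionM hact) e actD !actZ => k; rewrite !mxE.
by rewrite addr_ge0// mulr_ge0//; [case: nij|case: nij].
Qed.

End Positivity.

(** * Spectral theory: the form is positive definite on the kernel of [norm1 o] *)

Lemma char_poly_similar (F : fieldType) n (P D : 'M[F]_n) : P \in unitmx ->
  char_poly (invmx P *m D *m P) = char_poly D.
Proof.
move=> Pu; have Pu' : map_mx polyC P \in unitmx by rewrite map_unitmx.
rewrite /char_poly /char_poly_mx !map_mxM map_invmx.
rewrite -[X in X - _](mulmxKV Pu') -scalar_mxC -mulmxBl -mulmxBr.
by rewrite !det_mulmx det_inv mulrAC mulVr ?mul1r// -unitmxE.
Qed.

Section Signature.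
Variables (R : realType) (n : nat) (B : 'M[R]_n) (o : 'rV[R]_n).
Hypotheses (Bsym : B^T = B) (hsig : has_signature B n.-1 1).
Hypothesis ho : normalizing_eigenvector B o.

Local Notation "M ^t*" := (map_mx Num.conj (M^T)) (at level 30).

(** Over the complex numbers [B] is Hermitian, hence unitarily diagonalizable with real eigenvalues.
    By unique factorization of the characteristic polynomial, these are the roots counted by the
    signature. *)
Lemma spectral_decomposition : exists (P : 'M[R[i]]_n) (d : 'I_n -> R),
  [/\ P \is unitarymx,
      map_mx (real_complex R) B = P^t* *m diag_mx (\row_j (d j)%:C%C) *m P,
      (forall j, d j != 0) &
      forall j k, d j < 0 -> d k < 0 -> j = k].
Proof.
set A := map_mx _ B.
have rA : A \is a realmx.
  by apply/mxOverP => i j; rewrite mxE; apply/complex_realP; exists (B i j).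
have sA : A \is symmetricmx.
  by apply/is_hermitianmxP; rewrite expr0 scale1r map_mx_id// /A map_trmx Bsym.
have /orthomx_spectralP := symmetric_normalmx sA rA.
have /mxOverP rd := hermitian_spectral_diag_real (realsym_hermsym sA rA).
have uP := spectral_unitarymx A.
move: (spectralmx A) (spectral_diag A) uP rd => P D uP rd AE.
have DE : D = \row_j (complex.Re (D 0 j))%:C%C.
  by apply/rowP => j; rewrite mxE RRe_real.
set d := fun j => complex.Re (D 0 j).
have [r [Br rpos rneg]] := hsig.
have dr : perm_eq [seq d j | j <- enum 'I_n] r.
  apply: (perm_map_inj (@complexI R)); apply: prod_XsubC_eq.
  rewrite [RHS]prod_map_poly -Br map_char_poly -/A AE char_poly_similar ?unitarymx_unit//.
  rewrite char_poly_trig ?diag_mx_is_trig// !big_map -[Finite.enum _]enumT big_enum.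
  by apply: eq_bigr => j _; rewrite DE !mxE eqxx.
have cneg : #|[pred j | d j < 0]| = 1%N.
  by rewrite -rneg -(permP dr) count_map cardE size_filter enumT.
have cpos : #|[pred j | 0 < d j]| = n.-1.
  by rewrite -rpos -(permP dr) count_map cardE size_filter enumT.
exists P, d; split=> //.
- by rewrite -DE -(invmx_unitary uP).
(* A zero eigenvalue would leave fewer than [n] indices for the [n.-1] positive and the one negative
   eigenvalue. *)
- move=> j; apply/eqP => dj0.
  have : (#|[pred j | (d j < 0)%R]| + #|[pred j | (0 < d j)%R]| < #|'I_n|)%N.
    rewrite -cardUI (@eq_card0 _ [predI _ & _]) ?addn0; last first.
      by move=> k; rewrite !inE; case: ltgtP.
    apply/proper_card/properP; split; first exact: subset_predT.
    by exists j => //; rewrite !inE dj0 ltxx.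
  by rewrite cneg cpos card_ord; lia.
- move=> j k dj dk.
  have /card_le1P/(_ j) : (#|[pred j | (d j < 0)%R]| <= 1)%N by rewrite cneg.
  by move=> /(_ dj k); rewrite !inE dk => /esym/eqP.
Qed.

(** In a unitary eigenbasis [o] is supported on the unique negative coordinate. As [norm1 o v = 0]
    is Euclidean orthogonality to [o], that coordinate of [v] vanishes and only positive eigenvalues
    contribute. *)
Lemma bform_pos_def v : norm1 o v = 0 -> v != 0 -> 0 < bform B v v.
Proof.
move=> vo v0; have [[a a0 oB] _ o0] := ho.
have [P [d [uP BE d0 dneg]]] := spectral_decomposition.
set f := real_complex R in BE.
have fJ m' (M : 'M[R]_(m', n)) : (map_mx f M)^t* = map_mx f M^T.
  by apply/matrixP => i j; rewrite !mxE; exact: conjc_real.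
pose coord w : 'rV_n := map_mx f w *m P^t*.
have coordE u w : coord u *m (coord w)^t* = map_mx f (u *m w^T).
  rewrite /coord trmx_mul map_mxM /= trmxCK mulmxA mulmxKtV//.
  by rewrite fJ -map_mxM.
(* Compare the two expressions of [o *m B] in the eigenbasis: [a] and [d j] scale the same
   coordinate. *)
have eig j : d j != a -> coord o 0 j = 0.
  move=> da; have : coord (o *m B) = coord o *m diag_mx (\row_j (f (d j))).
    by rewrite /coord map_mxM BE !mulmxA mulmxtVK.
  rewrite oB /coord map_mxZ -scalemxAl -/(coord o) => /rowP/(_ j).
  rewrite mul_mx_diag !mxE => /eqP; rewrite mulrC -subr_eq0 -mulrBr mulf_eq0.
  by rewrite -rmorphB fmorph_eq0 subr_eq0 [a == _]eq_sym (negbTE da) orbF => /eqP.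
have coord_neq0 u : u != 0 -> exists j, coord u 0 j != 0.
  move=> u0; apply/existsP; apply: contraNT u0; rewrite negb_exists => /forallP h.
  rewrite -(map_mx_eq0 f) -[map_mx f u](mulmxKtV _ uP)// -/(coord u).
  rewrite (_ : coord u = 0) ?mul0mx//.
  by apply/rowP => j; rewrite [RHS]mxE; apply/eqP; have := h j; rewrite negbK.
have coordB u : f (bform B u u) =
    (coord u *m diag_mx (\row_j f (d j)) *m (coord u)^t*) 0 0.
  rewrite /coord trmx_mul [in RHS]map_mxM /= trmxCK fJ mulmxA.
  rewrite (_ : map_mx f u *m _ *m _ *m P = map_mx f (u *m B)).
    by rewrite -map_mxM mxE.
  by rewrite map_mxM BE !mulmxA.
clearbody coord.
have o_neq0 : o != 0.
  apply/eqP => oz; have [_ /eqP] := ho; rewrite oz /euclidean_norm big1.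
    by rewrite sqrtr0 eq_sym oner_eq0.
  by move=> i _; rewrite mxE expr0n.
have [j0 cj0] := coord_neq0 _ o_neq0.
have dj0 : d j0 = a by apply/eqP; apply: contraNT cj0 => /eig ->.
have coord_o j : j != j0 -> coord o 0 j = 0.
  move=> jj0; apply: eig; apply: contra_neq jj0 => dja.
  by apply: dneg; rewrite ?dja ?dj0.
have coord_v : coord v 0 j0 = 0.
  have : (coord v *m (coord o)^t*) 0 0 = 0.
    rewrite coordE mxE -(rmorph0 f) -[in RHS]vo; congr (f _).
    by rewrite mxE; apply: eq_bigr => i _; rewrite mxE mulrC.
  rewrite mxE (bigD1 j0)//= big1 => [|j jj0]; last by rewrite !mxE coord_o// conjC0 mulr0.
  by rewrite addr0 !mxE => /eqP; rewrite mulf_eq0 conjC_eq0 (negbTE cj0) orbF => /eqP.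
have [j1 cj1] := coord_neq0 _ v0.
have dpos j : j != j0 -> 0 < d j.
  move=> jj0; rewrite lt_neqAle eq_sym d0 leNgt; apply/negP => dj.
  by move/eqP: jj0; apply; apply: dneg; rewrite ?dj0.
rewrite -ltcR (_ : (bform B v v)%:C%C = \sum_j f (d j) * `|coord v 0 j| ^+ 2); last first.
  rewrite [LHS]coordB.
  rewrite mxE; apply: eq_bigr => j _.
  by rewrite mul_mx_diag !mxE normCK mulrCA mulrA.
have j1j0 : j1 != j0 by apply: contra_neq cj1 => ->.
rewrite (bigD1 j1)//= ltr_wpDr//.
  apply: sumr_ge0 => j _; have [->|/dpos/ltW dj] := eqVneq j j0.
    by rewrite coord_v normr0 expr0n mulr0.
  by rewrite mulr_ge0 ?exprn_ge0// ler0c.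
by rewrite mulr_gt0 ?exprn_gt0 ?normr_gt0// ltcR dpos.
Qed.

End Signature.

(** * Limits of injective sequences form a closed set *)

Section InjectiveLimits.
Variables (R : realType) (T : pseudoMetricType R) (A : set T).

(** When [A] is the set of normalized roots, this unfolds to [limit_roots]. *)
Definition injective_limits : set T :=
  [set x | exists u : nat -> T, [/\ injective u, forall k, A (u k) & u @ \oo --> x]].

(** Each ball contains an injective tail of the sequence. Conversely, points are chosen one by one
    in shrinking balls, each avoiding the finitely many earlier ones. *)
Lemma injective_limitsP x : injective_limits x <->
  forall e : R, 0 < e -> infinite_set (A `&` ball x e).
Proof.
split=> [[u [uinj uA ux]] e e0 fin|h].
  have [M _ Mu] : \forall k \near \oo, ball x e (u k) by exact: (cvg_ball ux).
  apply: infinite_nat.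
  have /eq_finite_set <- : ((fun k => u (k + M)%N) @` [set: nat] #= [set: nat])%card.
    by apply: inj_card_eq => j k _ _ /uinj /addIn.
  apply: sub_finite_set fin => _ [k _ <-]; split; first exact: uA.
  by apply: Mu; rewrite /= leq_addl.
(* [l] lists the points already chosen, so its size also fixes the next radius. *)
have pick l : exists a : T, [/\ A a, ball x (size l).+1%:R^-1 a & a \notin l].
  apply: contrapT => no; apply: (h (size l).+1%:R^-1); first by rewrite invr_gt0.
  apply: (@sub_finite_set _ _ [set` l]) => [a [Aa xa] /=|]; last exact: finite_seq.
  by apply: contrapT => /negP al; apply: no; exists a.
have {pick}[f fP] := choice pick.
have [prefix [p0 pS]] : exists prefix : nat -> seq T,
    prefix 0%N = [::] /\ forall k, prefix k.+1 = f (prefix k) :: prefix k.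
  by exists (fun k => iter k (fun l => f l :: l) [::]).
have sz k : size (prefix k) = k by elim: k => [|k IH]; rewrite ?p0 ?pS//= IH.
have mem_prefix j k : (j < k)%N -> f (prefix j) \in prefix k.
  elim: k => // k IH; rewrite ltnS leq_eqVlt pS in_cons => /predU1P[->|/IH ->].
    by rewrite eqxx.
  by rewrite orbT.
have fresh j k : (j < k)%N -> f (prefix j) <> f (prefix k).
  by move=> /mem_prefix jk e; have [_ _ /negP] := fP (prefix k); rewrite -e.
exists (fun k => f (prefix k)); split.
- by move=> j k jk; case: (ltngtP j k) => // [/fresh/(_ jk)|/fresh/(_ (esym jk))].
- by move=> k; have [] := fP (prefix k).
- apply/cvg_ballP => e e0; near=> k; have [_ + _] := fP (prefix k); rewrite sz.
  apply: le_ball; apply: ltW; near: k; exact: near_infty_natSinv_lt (PosNum e0).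
Unshelve. all: end_near. Qed.

Lemma closed_injective_limits : closed injective_limits.
Proof.
move=> x cx; apply/injective_limitsP => e e0.
have e20 : 0 < e / 2 by rewrite divr_gt0.
have [y [/injective_limitsP Ly xy]] := cx _ (nbhsx_ballx x (e / 2) e20).
have := Ly _ e20; apply: contra_not => fin.
apply: sub_finite_set fin => z [Az yz]; split=> //.
by rewrite [e](splitr e); exact: (ball_triangle xy).
Qed.

End InjectiveLimits.

(** * Coordinatewise convergence of row vectors *)

Section RowLimits.
Variables (R : realType) (n : nat).
Implicit Types (u v : nat -> 'rV[R]_n) (x y : 'rV[R]_n).

Lemma cvg_coord u x i : u @ \oo --> x -> (fun k => u k 0 i) @ \oo --> x 0 i.
Proof. move=> ux; exact: (cvg_comp _ _ ux (@coord_continuous _ _ _ 0 i x)). Qed.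

Lemma cvg_row u x : (forall i, (fun k => u k 0 i) @ \oo --> x 0 i) -> u @ \oo --> x.
Proof.
move=> ux; apply/cvg_ballP => e e0.
have : \forall k \near \oo, forall i, ball (x 0 i) e (u k 0 i).
  by apply: filter_forall => i; exact: (cvg_ball (ux i)).
by apply: filterS => k uk; split=> // i j; rewrite ord1.
Qed.

End RowLimits.

(** * Roots, the normalizing form [N] and the fundamental chamber *)

Section Geometry.
Variables (R : realType) (n : nat).
Variables (m : 'I_n -> 'I_n -> option nat) (W : groupType) (s : 'I_n -> W).
Variables (B : 'M[R]_n) (act : W -> 'rV[R]_n -> 'rV[R]_n) (o : 'rV[R]_n).
Hypotheses (hW : coxeter_system m s) (hB : coxeter_form m B).
Hypotheses (hsig : has_signature B n.-1 1) (hact : coxeter_action s B act).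
Hypothesis ho : normalizing_eigenvector B o.
Implicit Types (w : W) (u v x y z : 'rV[R]_n) (i j : 'I_n).

Local Notation bf := (bform B).
Local Notation alpha := (@simple_root R n).
Local Notation N := (norm1 o).
Local Notation len := (word_length (generator_word hW)).

Lemma norm1D u v : N (u + v) = N u + N v.
Proof. by rewrite /norm1 -big_split; apply: eq_bigr => i _; rewrite mxE mulrDr. Qed.

Lemma norm1Z a v : N (a *: v) = a * N v.
Proof. by rewrite /norm1 mulr_sumr; apply: eq_bigr => i _; rewrite mxE mulrCA. Qed.

Lemma norm1N v : N (- v) = - N v.
Proof. by rewrite -scaleN1r norm1Z mulN1r. Qed.

Lemma norm1_gt0 v : nonneg_row v -> v != 0 -> 0 < N v.
Proof.
move=> v0 vn; have [_ _ o0] := ho.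
have t0 i : 0 <= o 0 i * v 0 i by rewrite mulr_ge0// ltW.
rewrite lt_neqAle sumr_ge0// andbT eq_sym; apply: contraNneq vn => Nv.
have /eqP := Nv; rewrite psumr_eq0// => /allP vi.
apply/eqP/rowP => i; rewrite mxE.
have /eqP/eqP := vi i (mem_index_enum i).
by rewrite mulf_eq0 gt_eqF//= => /eqP.
Qed.

Lemma bform_eigenvector : exists2 a, a < 0 & forall v, bf o v = a * N v.
Proof.
have [[a a0 oB] _ _] := ho; exists a => // v.
rewrite /bform oB -scalemxAl mxE; congr (_ * _); rewrite mxE.
by apply: eq_bigr => i _; rewrite mxE.
Qed.

Lemma bform_act_simple_root w i :
  bf (act w (alpha i)) (act w (alpha i)) = 1.
Proof. by rewrite (bform_act hW hB hact) (coxeter_form_diag hB). Qed.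

Lemma root_neq0 w i : act w (alpha i) != 0.
Proof.
apply/eqP => h; have := bform_act_simple_root w i; rewrite h -(scale0r 0).
by rewrite !bformE mul0r => /esym/eqP; rewrite oner_eq0.
Qed.

Lemma generatorK w i : (w * s i * s i = w)%g.
Proof. by rewrite -mulgA (generator_invol hW) mulg1. Qed.

(** [w * s i] sends [alpha i] to the opposite root, and multiplying it by [s i] lengthens it, so
    [nonneg_act] applies to it. *)
Lemma norm1_root_le0 w i : (len (w * s i)%g < len w)%N -> N (act w (alpha i)) < 0.
Proof.
move=> h; rewrite -oppr_gt0 -norm1N.
have -> : - act w (alpha i) = act (w * s i)%g (alpha i).
  by rewrite (coxeter_actionM hact) (act_simple_root_self hB hact) (actN hact).
apply: norm1_gt0; last exact: root_neq0.
by apply: (nonneg_act hB hact); rewrite generatorK ltnW.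
Qed.

Lemma norm1_root_neq0 w i : N (act w (alpha i)) != 0.
Proof.
have [h|/norm1_root_le0 h] := leqP (len w) (len (w * s i)%g); last by rewrite lt_eqF.
by rewrite gt_eqF// norm1_gt0 ?root_neq0//; exact: (nonneg_act hB hact).
Qed.

(* [bf o] is negative on the simple roots, so [o] lies in the open fundamental
   chamber, and only the identity keeps it there. *)
Lemma chamber_stabilizer w : (forall i, bf (act w o) (alpha i) < 0) -> w = 1%g.
Proof.
have [a a0 oE] := bform_eigenvector; move=> h.
(* For a last letter [s i] of [w^-1], the root [act w^-1 (alpha i)] has negative [N]; but [h i] says
   that its product with [o], a negative multiple of [N], is negative. *)
suff w1 : (w^-1 = 1)%g by rewrite -[w]invgK w1 invg1.
apply: (@word_length_eq0 _ _ s (generator_word hW)).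
apply/eqP; rewrite -leqn0 leqNgt; apply/negP => l0.
have [i /norm1_root_le0 wi] := word_length_gt0 (generator_invol hW) l0.
have := h i; rewrite -(bform_act hW hB hact w^-1) -(coxeter_actionM hact) mulVg.
by rewrite (coxeter_action1 hact) oE nmulr_rlt0// ltNge ltW.
Qed.

Lemma bform_pos v : N v = 0 -> v != 0 -> 0 < bf v v.
Proof.
apply: (bform_pos_def _ hsig ho); apply/matrixP => i j; rewrite mxE.
have E k l : bf (alpha k) (alpha l) = B k l.
  by rewrite /bform -rowE trmx_delta -colE !mxE.
by rewrite -!E (coxeter_form_sym hB).
Qed.

Lemma norm1_isotropic v : bf v v = 0 -> v != 0 -> N v != 0.
Proof. by move=> v0 vn; apply: contra_eq_neq v0 => /bform_pos -/(_ vn)/gt_eqF ->. Qed.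

Lemma bform_isotropic_neq0 x y : N x = 1 -> N y = 1 -> bf x x = 0 -> bf y y = 0 ->
  x != y -> bf x y != 0.
Proof.
move=> Nx Ny xx yy xy; have := @bform_pos (x - y).
rewrite norm1D norm1N Nx Ny subrr subr_eq0 => /(_ erefl xy).
rewrite !bformE xx yy (coxeter_form_sym hB y x) => h.
by apply/eqP => xy0; move: h; rewrite xy0; lra.
Qed.

(** * Reflections and normalized roots *)

Definition reflection z v : 'rV[R]_n := v - (2 * bf z v / bf z z) *: z.

Lemma reflectionZ a z v : a != 0 -> reflection (a *: z) v = reflection z v.
Proof.
move=> a0; rewrite /reflection !bformE scalerA; congr (_ - _ *: _).
(* For isotropic [z] the inverse of 0 is 0, and both reflections are the identity. *)
have [->|z0] := eqVneq (bf z z) 0; first by rewrite !mulr0 !invr0 !mulr0 mul0r.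
by field; rewrite z0 a0.
Qed.

Lemma reflectionK z : bf z z != 0 -> involutive (reflection z).
Proof.
move=> z0 v; rewrite /reflection !bformE.
apply/rowP => k; rewrite !mxE; field.
exact: z0.
Qed.

Lemma reflection_self z : bf z z != 0 -> reflection z z = - z.
Proof.
move=> z0; rewrite /reflection mulfK// scaler_nat mulr2n opprD.
by rewrite addrA subrr sub0r.
Qed.

Lemma bform_reflection z u v : bf z z != 0 ->
  bf (reflection z u) v = bf u (reflection z v).
Proof.
move=> z0; rewrite /reflection !bformE (coxeter_form_sym hB u z); ring.
Qed.

Lemma act_reflection w z v : act w (reflection z v) = reflection (act w z) (act w v).
Proof.
by rewrite /reflection (actD hact) (actN hact) (actZ hact) !(bform_act hW hB hact).
Qed.

Local Notation A := (normalize o @` root_system act).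

Lemma normalize_scale a v : a != 0 -> normalize o (a *: v) = normalize o v.
Proof.
by move=> a0; rewrite /normalize norm1Z scalerA invfM mulrAC mulVf// mul1r.
Qed.

Lemma norm1_normalize v : N v != 0 -> N (normalize o v) = 1.
Proof. by move=> h; rewrite norm1Z mulVf. Qed.

(** The reflection in the root [act w (alpha i)] is the action of the conjugate [w * s i * w^-1],
    and rescaling the root does not change it. *)
Lemma normalized_rootP z : A z -> [/\ N z = 1, 0 < bf z z &
  exists w, act w =1 reflection z].
Proof.
move=> [_ [w [i ->]] <-]; set r := act w _.
have Nr : N r != 0 by exact: norm1_root_neq0.
have rr : bf r r = 1 by exact: bform_act_simple_root.
split; first exact: norm1_normalize.
  by rewrite !bformE rr mulr1 -expr2 exprn_even_gt0//= invr_neq0.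
exists (w * s i * w^-1)%g => v; rewrite reflectionZ ?invr_neq0//.
rewrite !(coxeter_actionM hact) (coxeter_action_gen hact).
transitivity (act w (reflection (alpha i) (act w^-1%g v))).
  by rewrite /reflection (coxeter_form_diag hB) divr1.
by rewrite act_reflection -(coxeter_actionM hact) mulgV (coxeter_action1 hact).
Qed.

(** The product of the two reflections keeps [o] in the chamber, so it is trivial. Evaluating it at
    [z'] shows that [z] and [z'] are proportional, and [N] is 1 on both. *)
Lemma reflection_inj z z' : A z -> A z' ->
  (forall i, bf (reflection z' o) (reflection z (alpha i)) < 0) -> z = z'.
Proof.
move=> /normalized_rootP[Nz zz [w wz]] /normalized_rootP[Nz' zz' [w' wz']] h.
have z0 : bf z z != 0 by rewrite gt_eqF.
have /(congr1 (fun w => act w z')) : (w * w' = 1)%g.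
  apply: chamber_stabilizer => i.
  by rewrite (coxeter_actionM hact) wz wz' bform_reflection.
rewrite (coxeter_actionM hact) (coxeter_action1 hact) wz wz'.
rewrite reflection_self ?gt_eqF// => /(congr1 (reflection z)).
rewrite reflectionK// /reflection => /eqP; rewrite -subr_eq0 opprB addrA.
move: (2 * _ / _) => c e.
have {e} e : c *: z = 2 *: z'.
  apply/eqP; rewrite -subr_eq0; move: e; congr (_ == _).
  by apply/rowP => k; rewrite !mxE; ring.
have := congr1 (fun v => N v) e; rewrite /= !norm1Z Nz Nz' !mulr1 => c2.
by move: e; rewrite c2 => /scalerI; apply; rewrite pnatr_eq0.
Qed.

(** * Continuity of the form, the reflections, the normalization and the action *)

Lemma cvg_scale (a : nat -> R) (b : R) (u : nat -> 'rV[R]_n) x :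
  a @ \oo --> b -> u @ \oo --> x -> (fun k => a k *: u k) @ \oo --> b *: x.
Proof.
move=> ab ux; apply: cvg_row => i; rewrite mxE; under eq_cvg do rewrite mxE.
by apply: cvgM => //; exact: cvg_coord.
Qed.

Lemma cvg_rowB (u v : nat -> 'rV[R]_n) x y :
  u @ \oo --> x -> v @ \oo --> y -> (fun k => u k - v k) @ \oo --> x - y.
Proof.
move=> ux vy; apply: cvg_row => i; rewrite !mxE; under eq_cvg do rewrite !mxE.
by apply: cvgB; exact: cvg_coord.
Qed.

Lemma cvg_sum (a : 'I_n -> nat -> R) (b : 'I_n -> R) :
  (forall i, a i @ \oo --> b i) ->
  (fun k => \sum_i a i k) @ \oo --> \sum_i b i.
Proof. by move=> h; apply: cvg_big => //; exact: add_continuous. Qed.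

Lemma cvg_norm1 (u : nat -> 'rV[R]_n) x :
  u @ \oo --> x -> (fun k => N (u k)) @ \oo --> N x.
Proof.
by move=> ux; apply: cvg_sum => i; apply: cvgM; [exact: cvg_cst|exact: cvg_coord].
Qed.

Lemma bform_sum u v : bf u v = \sum_i (\sum_j u 0 j * B j i) * v 0 i.
Proof. by rewrite /bform mxE; apply: eq_bigr => i _; rewrite !mxE. Qed.

Lemma cvg_bform (u v : nat -> 'rV[R]_n) x y :
  u @ \oo --> x -> v @ \oo --> y -> (fun k => bf (u k) (v k)) @ \oo --> bf x y.
Proof.
move=> ux vy; rewrite bform_sum; under eq_cvg do rewrite bform_sum.
apply: cvg_sum => i; apply: cvgM; last exact: cvg_coord.
by apply: cvg_sum => j; apply: cvgM; [exact: cvg_coord|exact: cvg_cst].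
Qed.

Lemma cvg_reflection (u v : nat -> 'rV[R]_n) x y : bf x x != 0 ->
  u @ \oo --> x -> v @ \oo --> y ->
  (fun k => reflection (u k) (v k)) @ \oo --> reflection x y.
Proof.
move=> x0 ux vy; apply: cvg_rowB => //; apply: cvg_scale => //.
apply: cvgM; first by apply: cvgM; [exact: cvg_cst|exact: cvg_bform].
by apply: cvgV => //; exact: cvg_bform.
Qed.

Lemma cvg_normalize (u : nat -> 'rV[R]_n) x : N x != 0 ->
  u @ \oo --> x -> (fun k => normalize o (u k)) @ \oo --> normalize o x.
Proof.
by move=> x0 ux; apply: cvg_scale => //; apply: cvgV => //; exact: cvg_norm1.
Qed.

Lemma act_sum w v k : act w v 0 k = \sum_i v 0 i * act w (alpha i) 0 k.
Proof.
rewrite {1}(row_sum_delta v) (big_morph (act w) (actD hact w) (act0 hact w)) summxE.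
by apply: eq_bigr => i _; rewrite (actZ hact) mxE.
Qed.

Lemma cvg_act w (u : nat -> 'rV[R]_n) x :
  u @ \oo --> x -> (fun k => act w (u k)) @ \oo --> act w x.
Proof.
move=> ux; apply: cvg_row => i; rewrite act_sum; under eq_cvg do rewrite act_sum.
by apply: cvg_sum => j; apply: cvgM; [exact: cvg_coord|exact: cvg_cst].
Qed.

(** * Limit roots and their orbits *)

Local Notation E := (limit_roots act o).

(* If [bf y y != 0], the reflections in [u k] converge to the reflection in [y],
   so the product of two consecutive ones nearly fixes [o]; it is then trivial
   by [chamber_stabilizer], which contradicts injectivity. *)
Lemma limit_root_isotropic y : E y -> N y = 1 /\ bf y y = 0.
Proof.
move=> [u [uinj uA uy]]; split.
  have Nu k : N (u k) = 1 by have [] := normalized_rootP (uA k).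
  have := cvg_norm1 uy; under eq_cvg do rewrite Nu.
  by move/(cvg_lim (@Rhausdorff R)) => <-; exact: lim_cst.
have [//|y0] := eqVneq (bf y y) 0; exfalso.
have uSy : (fun k => u k.+1) @ \oo --> y by rewrite (cvg_shiftS u).
have [a a0 oE] := bform_eigenvector.
have : \forall k \near \oo, forall i,
    bf (reflection (u k.+1) o) (reflection (u k) (alpha i)) < 0.
  apply: filter_forall => i.
  (* At the limit the two reflections cancel, leaving [bf o (alpha i)]; the strict inequality
     persists for large [k]. *)
  have : bf (reflection y o) (reflection y (alpha i)) < 0.
    rewrite bform_reflection// reflectionK// oE nmulr_rlt0//.
    have := norm1_root_neq0 1%g i; rewrite (coxeter_action1 hact) => al.
    apply: norm1_gt0; last by rewrite -(coxeter_action1 hact (alpha i)) root_neq0.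
    by move=> k; rewrite mxE ler0n.
  apply: cvgr_lt; apply: cvg_bform; apply: cvg_reflection => //; exact: cvg_cst.
case=> k _ /(_ k (leqnn k)) /(reflection_inj (uA k) (uA k.+1)) /uinj.
by move/eqP; rewrite -[X in X == _]addn0 -addn1 eqn_add2l.
Qed.

(** The normalized action is thus defined at limit roots: [act w x] is isotropic and nonzero,
    whereas nonzero vectors with [N = 0] have positive square. *)
Lemma isotropic_act_norm1 w x : E x -> N (act w x) != 0.
Proof.
move=> /limit_root_isotropic[Nx xx]; apply: norm1_isotropic.
  by rewrite (bform_act hW hB hact).
apply/eqP => /(congr1 (act w^-1%g)).
rewrite (act0 hact) -(coxeter_actionM hact) mulVg (coxeter_action1 hact) => x0.
by move: Nx; rewrite x0 -(scale0r 0) norm1Z mul0r => /esym/eqP; rewrite oner_eq0.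
Qed.

Lemma limit_root_act w x : E x -> E (normalize o (act w x)).
Proof.
move=> Ex; have [u [uinj uA ux]] := Ex.
have Nu k : N (u k) = 1 by have [] := normalized_rootP (uA k).
have uw k : A (normalize o (act w (u k))) /\ N (act w (u k)) != 0.
  have [_ [w' [i ->]] <-] := uA k.
  have Ni := norm1_root_neq0 w' i.
  rewrite (actZ hact) normalize_scale ?invr_neq0// -(coxeter_actionM hact); split.
    by exists (act (w * w')%g (alpha i)) => //; exists (w * w')%g, i.
  by rewrite norm1Z mulf_neq0 ?invr_neq0 ?norm1_root_neq0.
exists (fun k => normalize o (act w (u k))); split.
(* After cancelling [w], applying [N] to both sides shows that the two scaling factors agree. *)
- move=> j k; rewrite /normalize -!(actZ hact) => /(congr1 (act w^-1%g)).
  rewrite -!(coxeter_actionM hact) mulVg !(coxeter_action1 hact) => e.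
  have := congr1 (norm1 o) e; rewrite !norm1Z !Nu !mulr1 => c.
  move: e; rewrite c => /scalerI ujk; apply/uinj/ujk.
  by rewrite invr_neq0//; have [] := uw k.
- by move=> k; have [] := uw k.
- by apply: cvg_normalize; [exact: isotropic_act_norm1|exact: cvg_act].
Qed.

Lemma limit_root_closure x y : E x -> E y -> closure (normalized_orbit act o x) y.
Proof.
move=> /limit_root_isotropic[Nx xx] Ey.
have [Ny yy] := limit_root_isotropic Ey.
have [->|yx] := eqVneq y x.
  apply: subset_closure; exists 1%g => //.
  by rewrite (coxeter_action1 hact) /normalize Nx invr1 scale1r.
have yx0 : bf y x != 0 by exact: bform_isotropic_neq0.
have [u [_ uA uy]] := Ey.
(* The reflection of [x] in [u k] is multiplied by [bf (u k) (u k)], which normalization ignores: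
   this clears the denominator tending to 0 and leaves a nonzero multiple of [y] in the limit. *)
have : (fun k => normalize o (bf (u k) (u k) *: x - (2 * bf (u k) x) *: u k)) @ \oo -->
    normalize o (bf y y *: x - (2 * bf y x) *: y).
  apply: cvg_normalize.
    by rewrite yy scale0r sub0r norm1N norm1Z Ny mulr1 oppr_eq0 mulf_neq0.
  apply: cvg_rowB; apply: cvg_scale => //; try exact: cvg_cst.
    exact: cvg_bform.
  by apply: cvgM; [exact: cvg_cst|apply: cvg_bform => //; exact: cvg_cst].
rewrite yy scale0r sub0r -scaleNr normalize_scale; last first.
  by rewrite oppr_eq0 mulf_neq0.
rewrite {2}/normalize Ny invr1 scale1r => cv U /cv[k _ /(_ k (leqnn k))/= Uk].
have [_ uu [w wu]] := normalized_rootP (uA k).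
have uk0 : bf (u k) (u k) != 0 by rewrite gt_eqF.
exists (normalize o (act w x)); split; first by exists w.
rewrite wu -(normalize_scale _ uk0) /reflection scalerBr scalerA.
by rewrite mulrC mulfVK.
Qed.

End Geometry.

Theorem theorem1p3 (R : realType) (n : nat)
    (m : 'I_n -> 'I_n -> option nat) (W : groupType) (s : 'I_n -> W)
    (B : 'M[R]_n) (act : W -> 'rV[R]_n -> 'rV[R]_n) (o : 'rV[R]_n)
    (hW : coxeter_system m s) (hirr : coxeter_irreducible m)
    (hB : coxeter_form m B) (hsig : has_signature B n.-1 1)
    (hact : coxeter_action s B act) (ho : normalizing_eigenvector B o)
    (x : 'rV[R]_n) (hx : limit_roots act o x) :
  closure (normalized_orbit act o x) = limit_roots act o.
Proof.
apply/seteqP; split=> y; last exact: (limit_root_closure hW hB hsig hact ho).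
move=> xy; apply: closed_injective_limits; apply: closure_subset xy => _ [w _ <-].
exact: (limit_root_act hW hB hsig hact ho).
Qed.
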